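(* For every $n\ge2$, the Garside element of the Artin monoid $\mathcal{M}(B_n)$ is $$\Delta(B_n)=x_1(x_2x_1x_2)(x_3x_2x_1x_2x_3)\cdots(x_nx_{n-1}\cdots x_2x_1x_2\cdots x_{n-1}x_n).$$
   Context: $\mathcal{M}(B_n)$ is the monoid with generators $x_1,\dots,x_n$ and relations $x_1x_2x_1x_2=x_2x_1x_2x_1$, $x_{i+1}x_ix_{i+1}=x_ix_{i+1}x_i$ for $2\le i\le n-1$, and $x_ix_j=x_jx_i$ for $|i-j|\ge2$. The notation $\alpha\mid_L\beta$ means $\beta=\alpha\rho$ for some element $\rho$. The Garside element $\Delta$ of this monoid is the unique element such that $x_i\mid_L\Delta$ for all $i$, and whenever $x_i\mid_L\omega$ for all $i$ then $\Delta\mid_L\omega$. *)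

(* Defs.v *)
From HB Require Import structures.
From mathcomp Require Import all_boot.
From mathcomp.classical Require Import boolp.

Set Implicit Arguments.
Unset Strict Implicit.
Unset Printing Implicit Defensive.

Local Open Scope quotient_scope.

Section PresentedMonoid.
Variables (T : choiceType) (r : seq T -> seq T -> Prop).

Inductive word_cong : seq T -> seq T -> Prop :=
  | wc_rel u v : r u v -> word_cong u v
  | wc_refl u : word_cong u u
  | wc_sym u v : word_cong u v -> word_cong v u
  | wc_trans v u w : word_cong u v -> word_cong v w -> word_cong u w
  | wc_cat u u' v v' :
      word_cong u u' -> word_cong v v' -> word_cong (u ++ v) (u' ++ v').

Definition word_congb : rel (seq T) := fun u v => `[< word_cong u v >].

Lemma word_congb_equiv : equiv_class_of word_congb.
Proof.
split=> [u | u v | v u w].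
- by apply/asboolP; apply: wc_refl.
- by apply/asboolP/asboolP; apply: wc_sym.
- by move=> /asboolP uv /asboolP vw; apply/asboolP; apply: wc_trans uv vw.
Qed.

Canonical word_congb_rel := EquivRelPack word_congb_equiv.

(* The monoid < T | u = v for all u, v with r u v >. *)
Definition presented_monoid := {eq_quot word_congb}.

HB.instance Definition _ := Choice.on presented_monoid.
HB.instance Definition _ := EqQuotient.on presented_monoid.

Definition word_class (u : seq T) : presented_monoid := \pi u.

Lemma word_classP u v : word_class u = word_class v <-> word_cong u v.
Proof. by split=> [/eqquotP /asboolP | uv]; last apply/eqquotP/asboolP. Qed.

Lemma word_class_repr (a : presented_monoid) : word_class (repr a) = a.
Proof. exact: reprK. Qed.

Definition pm_mul (a b : presented_monoid) := word_class (repr a ++ repr b).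

Lemma pm_mulE u v : pm_mul (word_class u) (word_class v) = word_class (u ++ v).
Proof. by apply/word_classP; apply: wc_cat; apply/word_classP/word_class_repr. Qed.

Lemma pm_mulA : associative pm_mul.
Proof.
move=> a b c; rewrite -[a]word_class_repr -[b]word_class_repr.
by rewrite -[c]word_class_repr !pm_mulE catA.
Qed.

Lemma pm_mul1r : left_id (word_class [::]) pm_mul.
Proof. by move=> a; rewrite -[a]word_class_repr pm_mulE. Qed.

Lemma pm_mulr1 : right_id (word_class [::]) pm_mul.
Proof. by move=> a; rewrite -[a]word_class_repr pm_mulE cats0. Qed.

HB.instance Definition _ :=
  isMonoid.Build presented_monoid pm_mulA pm_mul1r pm_mulr1.

End PresentedMonoid.

(* The ordinal i : 'I_n stands for the generator x_{i+1}. *)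
Inductive artinB_rel (n : nat) : seq 'I_n -> seq 'I_n -> Prop :=
  | artinB_rel4 (i j : 'I_n) : val i = 0 -> val j = 1 ->
      artinB_rel [:: i; j; i; j] [:: j; i; j; i]
  | artinB_rel3 (i j : 'I_n) : 0 < i -> val j = i.+1 ->
      artinB_rel [:: j; i; j] [:: i; j; i]
  | artinB_rel2 (i j : 'I_n) : i.+2 <= j \/ j.+2 <= i ->
      artinB_rel [:: i; j] [:: j; i].

Definition artinB (n : nat) : monoidType := presented_monoid (@artinB_rel n).

Definition xB (n : nat) (i : 'I_n) : artinB n :=
  word_class (@artinB_rel n) [:: i].

Local Open Scope group_scope.

Definition ldvd (M : monoidType) (a b : M) : Prop := exists c : M, b = a * c.

(* [unique P d], from the standard library: P d, and every d' with P d'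
   equals d. *)
Definition is_garside (n : nat) (d : artinB n) : Prop :=
  unique (fun d' : artinB n =>
      (forall i : 'I_n, ldvd (xB i) d') /\
      forall w : artinB n, (forall i : 'I_n, ldvd (xB i) w) -> ldvd d' w)
    d.

(* The block ending in generator k: first the generators of index <= k in
   decreasing order, then those of index from 1 to k in increasing order, so
   that the generator of index 0 occurs only once; this is
   x_{k+1} ... x_2 x_1 x_2 ... x_{k+1}, and x_1 for k = 0. *)
Definition blockB (n : nat) (k : 'I_n) : artinB n :=
  (\prod_(j <- rev (enum 'I_n) | (j <= k)%N) xB j) *
  (\prod_(j < n | (0 < j <= k)%N) xB j).

Definition deltaB (n : nat) : artinB n := \prod_(k < n) blockB k.

(* Main.v *)
Require Import Defs.
From mathcomp Require Import all_boot.
From mathcomp Require Import zify.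

(** Why the formula holds.  For two distinct generators let [C s t] be the word
such that [s C(s,t) = t C(t,s)] is the defining relation between them.  The
heart of the proof is that this relation gives the lcm: if [s a = t b] in the
monoid, then [a = C(s,t) c] and [b = C(t,s) c] for some [c]
([complement_lcm], [xB_mul_eq]); the case [s = t] is left cancellation.

This follows from a finite check.  Pushing complements through a rectangular
grid (word reversing) computes a common right multiple of two words, and it
computes their least one as far as the lcm property holds for generators
([reversal_lcm]).  Relations preserve length, so the lcm property is proved by
induction on length and, at a given length, along a derivation of
[s a = t b].  The only real step is transitivity, [s a = k d = t b], where [d]
is a shorter multiple of both [C(k,s)] and [C(k,t)], hence of their lcm; one
needs the cube condition saying that the result factors through [C(s,t)].  The
cube condition concerns three generators at a time, so it only depends on the
three entries of the Coxeter matrix, and reversing decides it by computation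
([cube_check]).

For the product itself, write [D_k] for the product of the first [k] blocks and
[x_0, x_1, ...] for the generators.  The complement of [x_k] after [D_k] is
the next block: [x_k] left divides [D_k b] exactly when the block ending in
[x_k] left divides [b] ([residue_garside]).  To see it, push [x_k] through the
letters of [D_k] one by one: nothing happens up to the last block of [D_k],
and then each letter of [x_{k-1} ... x_0 ... x_{k-1}] appends one letter, the
letter [x_0] two, so that [x_k] grows into [x_k ... x_0 ... x_k].  By
induction, [D_k] left divides exactly the common right multiples of
[x_0, ..., x_{k-1}] ([garside_ldvd]), which is the characteristic property of
the Garside element.  Uniqueness holds because lengths make left divisibility
antisymmetric ([ldvd_anti]). *)

Set Implicit Arguments.
Unset Strict Implicit.
Unset Printing Implicit Defensive.

(** * Word reversing and the cube condition in rank three *)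

Section Reversal.
Variables (T : Type) (C : T -> T -> seq T).

(** Word reversing: on success the result [(a, b)] satisfies [u a = v b] as soon
as [s C(s,t) = t C(t,s)] for all letters.  The grid for [s u', t v'] is split
into the corner cell [(s, t)] and three smaller grids.  The fuel [n] bounds the
recursion depth, since reversing need not terminate in general; letters are
never compared, equal letters being handled by [C s s = [::]]. *)
Fixpoint reversal (n : nat) (u v : seq T) : option (seq T * seq T) :=
  if n is n'.+1 then
    match u, v with
    | [::], _ => Some (v, [::])
    | _, [::] => Some ([::], u)
    | s :: u', t :: v' =>
      if reversal n' u' (C s t) is Some (p, q) then
        if reversal n' v' (C t s) is Some (p', q') then
          if reversal n' q q' is Some (x, y) then Some (p ++ x, p' ++ y)
          else None
        else None
      else None
    end
  else None.

End Reversal.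

(** Reversing commutes with relabelling, even a non injective one; this allows
computing with three formal letters that stand for arbitrary generators. *)
Lemma reversal_map (S T : Type) (f : S -> T)
    (CS : S -> S -> seq S) (CT : T -> T -> seq T) n u v a b :
    (forall s t, CT (f s) (f t) = map f (CS s t)) ->
    reversal CS n u v = Some (a, b) ->
  reversal CT n (map f u) (map f v) = Some (map f a, map f b).
Proof.
move=> CE; elim: n u v a b => //= n IHn [|s u] [|t v] a b /=;
  try by case=> <- <-.
case E1: reversal => [[p q]|] //; case E2: reversal => [[p' q']|] //.
case E3: reversal => [[x y]|] // [<- <-]; rewrite !CE.
by rewrite (IHn _ _ _ _ E1) (IHn _ _ _ _ E2) (IHn _ _ _ _ E3) !map_cat.
Qed.

(** Formal names for the generators of an equation [s a = k d = t b]. *)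
Variant corner := Cs | Ck | Ct.

Fixpoint alternating (T : Type) n (s t : T) : seq T :=
  if n is n'.+1 then s :: alternating n' t s else [::].

Lemma alternating_map (S T : Type) (f : S -> T) n s t :
  map f (alternating n s t) = alternating n (f s) (f t).
Proof. by elim: n s t => //= n IHn s t; rewrite IHn. Qed.

(** The diagonal value 1 yields empty complements, and a value 1 off the diagonal
makes two formal letters equivalent; triples with repeated generators are
therefore no special case. *)
Definition coxeter3 (a b c : nat) (p q : corner) : nat :=
  match p, q with
  | Cs, Ck | Ck, Cs => a
  | Ck, Ct | Ct, Ck => b
  | Cs, Ct | Ct, Cs => c
  | _, _ => 1
  end.

Definition artin_compl (T : Type) (m : T -> T -> nat) (s t : T) : seq T :=
  alternating (m s t).-1 t s.

(** The lcm of [C k s] and [C k t] yields a common multiple of [s], [k] and [t];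
the test is that it is a multiple of [lcm(s, t)].  A reversal that returns an
empty word shows a divisibility, and two empty words an equality. *)
Definition cube_check n (a b c : nat) : bool :=
  let C := artin_compl (coxeter3 a b c) in
  if reversal C n (C Ck Cs) (C Ck Ct) is Some (X, Y) then
    if reversal C n (C Cs Ck ++ X) (C Cs Ct) is Some ([::], Z) then
      if reversal C n (C Ct Ck ++ Y) (C Ct Cs ++ Z) is Some ([::], [::])
      then true else false
    else false
  else false.

Definition coxeterB n (i j : 'I_n) : nat :=
  if i == j :> nat then 1
  else if (i.+2 <= j) || (j.+2 <= i) then 2
  else if (i == 0 :> nat) || (j == 0 :> nat) then 4
  else 3.

Lemma coxeterB_sym n (i j : 'I_n) : coxeterB i j = coxeterB j i.
Proof. by rewrite /coxeterB eq_sym (orbC (_ < _)) (orbC (i == 0 :> nat)). Qed.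

(** A Coxeter graph on three vertices taken from that of B_n is a subgraph of a
path with at most one edge labelled 4.  The reversals for all these graphs
finish within depth 10. *)
Lemma cube_check_B n (i j k : 'I_n) :
  cube_check 10 (coxeterB i j) (coxeterB j k) (coxeterB i k).
Proof.
rewrite /coxeterB; case: i j k => [i _] [j _] [k _] /=.
(* The branches where the computation fails, such as the triangle (3, 3, 3),
   come from inconsistent inequalities between the indices. *)
by do 9?[case: ifP => ?]; try (by vm_compute); exfalso; lia.
Qed.

(** * Presentations whose relations are lcms of generators *)

Local Open Scope group_scope.

Section ComplementedPresentation.
Variables (T : choiceType) (r : seq T -> seq T -> Prop) (C : T -> T -> seq T).
Hypothesis C_diag : forall s, C s s = [::].
Hypothesis r_compl : forall u v, r u v ->
  exists s t, u = s :: C s t /\ v = t :: C t s.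
Hypothesis r_size : forall u v, r u v -> size u = size v.

Local Notation cl := (word_class r).

Lemma word_class_cat u v : cl (u ++ v) = cl u * cl v.
Proof. by rewrite -pm_mulE. Qed.

Lemma word_class_cons s u : cl (s :: u) = cl [:: s] * cl u.
Proof. by rewrite -word_class_cat. Qed.

Lemma word_class_surj (a : presented_monoid r) : exists u, cl u = a.
Proof. by exists (repr a); apply: word_class_repr. Qed.

Lemma word_class_size u v : cl u = cl v -> size u = size v.
Proof.
move=> /word_classP; elim=> {u v} [u v /r_size //| // |u v _ -> //|v u w _ -> _ -> //|].
by move=> u u' v v' _ eu _ ev; rewrite !size_cat eu ev.
Qed.

Lemma reversal_sound n u v a b :
    (forall s t, cl (s :: C s t) = cl (t :: C t s)) ->
    reversal C n u v = Some (a, b) ->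
  cl (u ++ a) = cl (v ++ b).
Proof.
move=> C_lcm; elim: n u v a b => //= n IHn [|s u] [|t v] a b /=;
  try by case=> <- <-; rewrite ?cats0.
case E1: (reversal C _ _ _) => [[p q]|] //.
case E2: (reversal C _ _ _) => [[p' q']|] //.
case E3: (reversal C _ _ _) => [[x y]|] // [<- <-].
have cat_cl w w' z : cl w = cl w' -> cl (w ++ z) = cl (w' ++ z).
  by rewrite !word_class_cat => ->.
rewrite word_class_cons [RHS]word_class_cons !catA (cat_cl _ _ x (IHn _ _ _ _ E1)).
rewrite (cat_cl _ _ y (IHn _ _ _ _ E2)) -!catA.
rewrite [in LHS]word_class_cat (IHn _ _ _ _ E3) [in RHS]word_class_cat.
by rewrite !mulgA -!word_class_cons C_lcm.
Qed.

(** The lcm property of generators, for equations between words of length at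
most [l]; the bound makes it usable as an induction hypothesis. *)
Definition lcm_upto (l : nat) := forall s t a b,
  size a < l -> cl (s :: a) = cl (t :: b) ->
  exists c, cl a = cl (C s t ++ c) /\ cl b = cl (C t s ++ c).

(** Each cell of the grid factors the given common multiple through the lcm of
its two sides, so the lcm property passes from letters to words.  All the
equations met on the way are between words no longer than [u ++ a]. *)
Lemma reversal_lcm l n u v p q a b : lcm_upto l ->
    reversal C n u v = Some (p, q) -> size (u ++ a) <= l ->
    cl (u ++ a) = cl (v ++ b) ->
  exists c, cl a = cl (p ++ c) /\ cl b = cl (q ++ c).
Proof.
move=> Hl; elim: n u v p q a b => //= n IHn [|s u] v p q a b.
  by case=> <- <- _ e; exists b.
case: v => [|t v]; first by case=> <- <- _ e; exists a.
rewrite /=.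
case E1: (reversal C _ _ _) => [[p1 q1]|] //.
case E2: (reversal C _ _ _) => [[p2 q2]|] //.
case E3: (reversal C _ _ _) => [[x y]|] // [<- <-] le_l e.
have sz := word_class_size e; rewrite /= in sz.
have [c [ea eb]] := Hl _ _ _ _ le_l e.
have sa := word_class_size ea; have sb := word_class_size eb.
have [|d [ad cd]] := IHn _ _ _ _ _ _ E1 _ ea; first exact: ltnW.
have [|d' [bd cd']] := IHn _ _ _ _ _ _ E2 _ eb; first by case: sz => <-; apply: ltnW.
have sc := word_class_size cd; rewrite cd in cd'.
have [|z [dz dz']] := IHn _ _ _ _ _ _ E3 _ cd'.
  by move: sa sc le_l; rewrite !size_cat; lia.
exists z; rewrite ad bd -!catA !(word_class_cat p1, word_class_cat p2).
by rewrite dz dz'.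
Qed.

(** Some common multiple of [s], [k] and [t] built from the lcm of [C k s] and
[C k t] is also a multiple of [s (C s t)], that is, of [t (C t s)]. *)
Definition cube_condition s k t := exists n X Y Z,
  [/\ reversal C n (C k s) (C k t) = Some (X, Y),
      cl (C s k ++ X) = cl (C s t ++ Z) & cl (C t k ++ Y) = cl (C t s ++ Z)].

Hypothesis cube : forall s k t, cube_condition s k t.

(** Induction on the length, then on the derivation of [s :: a = t :: b].  The
statement about derivations must also cover empty words, because the
congruence rule splits words at any place. *)
Lemma lcm_uptoT l : lcm_upto l.
Proof.
elim: l => // l IHl s t a b le_l /word_classP.
pose common u v := match u, v with
  | s :: a, t :: b => exists c,
      cl a = cl (C s t ++ c) /\ cl b = cl (C t s ++ c)
  | [::], [::] => True
  | _, _ => False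
  end.
suff red u v : word_cong r u v -> size u <= l.+1 -> common u v.
  by move/red; apply.
move=> {s t a b le_l}; elim=> {u v}
  [u v /r_compl[s [t [-> ->]]] _ | [|s a] _ | u v uv IH sz | | ].
- by exists [::]; rewrite !cats0.
- by [].
- by exists a; rewrite C_diag.
- have {IH}: common u v.
    by apply: IH; rewrite (word_class_size ((word_classP _ _ _).2 uv)).
  by case: u v {uv sz} => [|s a] [|t b] //= [c [? ?]]; exists c.
(* Transitivity: [s a = k d = t b], where [d] is one letter shorter, so that the
   induction hypothesis on lengths factors [d] through the lcm of [C k s] and
   [C k t]; the cube condition then rearranges the factors. *)
- move=> v u w uv IHu vw IHv sz; have := IHu sz.
  have {}uv := (word_classP _ _ _).2 uv.
  have {}sz' : size v <= l.+1 by rewrite -(word_class_size uv).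
  have := IHv sz'; case: u v w sz sz' {uv vw IHu IHv} => [|s a] [|k d] [|t b] //= _.
  rewrite ltnS => sz [f [df bf]] [e [ae de]].
  have [n [X [Y [Z [E eX eY]]]]] := cube s k t.
  have sd := word_class_size de; rewrite de in df.
  have [|g [eg fg]] := reversal_lcm IHl E _ df; first by rewrite -sd.
  exists (Z ++ g); rewrite ae bf !word_class_cat eg fg !word_class_cat !mulgA.
  by rewrite !word_class_cat in eX eY; rewrite eX eY.
(* The congruence rule: the first letters are those of the left factors, unless
   these are empty. *)
- move=> u u' v v' uu' IHu vv' IHv; rewrite size_cat => sz.
  have: common u u' by apply: IHu; lia.
  have: common v v' by apply: IHv; lia.
  case: u u' {uu' IHu sz} => [|s a] [|t b] //= _ [c [ac bc]].
  have {}vv' := (word_classP _ _ _).2 vv'.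
  by exists (c ++ v); rewrite !catA !(word_class_cat _ v, word_class_cat _ v') ac bc vv'.
Qed.

Lemma complement_lcm s t (a b : presented_monoid r) :
    cl [:: s] * a = cl [:: t] * b ->
  exists c, a = cl (C s t) * c /\ b = cl (C t s) * c.
Proof.
case: (word_class_surj a) (word_class_surj b) => u <- [v <-].
rewrite -!word_class_cat => /(lcm_uptoT (ltnSn (size u)))[c [-> ->]].
by exists (cl c); rewrite !word_class_cat.
Qed.

End ComplementedPresentation.

(** * The lcm of two generators of the Artin monoid of type B *)

Lemma cube_check_condition (T : choiceType) (r : seq T -> seq T -> Prop)
    (m : T -> T -> nat) n s k t :
    (forall i, m i i = 1%N) -> (forall i j, m i j = m j i) ->
    (forall i j, word_class r (i :: artin_compl m i j)
               = word_class r (j :: artin_compl m j i)) ->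
    cube_check n (m s k) (m k t) (m s t) ->
  cube_condition r (artin_compl m) s k t.
Proof.
move=> m_diag m_sym C_lcm.
pose f p := match p with Cs => s | Ck => k | Ct => t end.
have mf p q : m (f p) (f q) = coxeter3 (m s k) (m k t) (m s t) p q.
  by case: p q => [] [] //=; rewrite ?m_diag // m_sym.
rewrite /cube_check; set C := artin_compl _.
have Cf p q : artin_compl m (f p) (f q) = map f (C p q).
  by rewrite /artin_compl mf alternating_map.
have rev_cl u v a b : reversal C n u v = Some (a, b) ->
    word_class r (map f u ++ map f a) = word_class r (map f v ++ map f b).
  by move/(reversal_map Cf)/(reversal_sound C_lcm).
case E1: reversal => [[X Y]|] //; case E2: reversal => [[[|//] Z]|] //.
case E3: reversal => [[[|//] [|//]]|] // _.
exists n, (map f X), (map f Y), (map f Z); split.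
- by have := reversal_map Cf E1; rewrite -!Cf.
- by have := rev_cl _ _ _ _ E2; rewrite map_cat cats0 -!Cf.
- by have := rev_cl _ _ _ _ E3; rewrite !map_cat !cats0 -!Cf.
Qed.

Lemma artinB_rel_compl n (u v : seq 'I_n) : artinB_rel u v ->
  exists s t, u = s :: artin_compl (@coxeterB n) s t
           /\ v = t :: artin_compl (@coxeterB n) t s.
Proof.
case=> i j => [i0 j1 | i0 ji | far];
  [exists i, j; move: i0 j1 | exists j, i; move: i0 ji | exists i, j; move: far];
  rewrite /artin_compl /coxeterB; case: i j => [i ?] [j ?] /= *;
  by do 6?[case: ifP => /= ?]; try (exfalso; lia).
Qed.

Lemma artinB_compl_lcm n (s t : 'I_n) :
  word_class (@artinB_rel n) (s :: artin_compl (@coxeterB n) s t)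
  = word_class (@artinB_rel n) (t :: artin_compl (@coxeterB n) t s).
Proof.
wlog le_st : s t / s <= t.
  by move=> wlg; case: (leqP s t) => [|/ltnW] /wlg.
rewrite /artin_compl [coxeterB t s]coxeterB_sym /coxeterB.
case: eqP => [/val_inj -> //|/= ne_st].
case: ifP => [far|near] /=; first by apply/word_classP/wc_rel/artinB_rel2; lia.
case: ifP => [s0|s1] /=; apply/word_classP.
  by apply/wc_rel/artinB_rel4 => /=; lia.
by apply/wc_sym/wc_rel/artinB_rel3 => /=; lia.
Qed.

Lemma artinB_rel_size n (u v : seq 'I_n) : artinB_rel u v -> size u = size v.
Proof. by case. Qed.

Lemma xB_mul_eq n (s t : 'I_n) (a b : artinB n) : xB s * a = xB t * b ->
  exists c,
    a = word_class (@artinB_rel n) (artin_compl (@coxeterB n) s t) * c /\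
    b = word_class (@artinB_rel n) (artin_compl (@coxeterB n) t s) * c.
Proof.
apply: complement_lcm.
- by move=> i; rewrite /artin_compl /coxeterB eqxx.
- exact: artinB_rel_compl.
- exact: artinB_rel_size.
- move=> i j k; apply: (@cube_check_condition _ _ _ 10).
  + by move=> {}i; rewrite /coxeterB eqxx.
  + exact: coxeterB_sym.
  + exact: artinB_compl_lcm.
  + exact: cube_check_B.
Qed.

(** * Calculus of lcms in a monoid *)

Section LeftLcm.
Variable M : monoidType.
Implicit Types a b p q u v : M.

(** [u p = v q] is a least common right multiple of [u] and [v].  Naming both
complements [p] and [q] is what makes lcms of products computable. *)
Definition left_lcm u v p q := u * p = v * q /\
  forall a b, u * a = v * b -> exists c, a = p * c /\ b = q * c.

Lemma left_lcmC u v p q : left_lcm u v p q -> left_lcm v u q p.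
Proof.
case=> e min; split=> // a b /esym/min[c [-> ->]]; by exists c.
Qed.

(** The lcm grid: the complement of [u1 * u2] is computed by first pushing [v]
through [u1] and then what remains of it, [p], through [u2]. *)
Lemma left_lcmMl u1 u2 v p q p' q' :
  left_lcm u1 v p q -> left_lcm u2 p p' q' -> left_lcm (u1 * u2) v p' (q * q').
Proof.
move=> [e1 min1] [e2 min2]; split; first by rewrite -mulgA e2 !mulgA e1.
move=> a b; rewrite -mulgA => /min1[c [/min2[d [-> ->]] ->]].
by exists d; rewrite mulgA.
Qed.

Lemma left_lcmMr u v1 v2 p q p' q' :
  left_lcm u v1 p q -> left_lcm q v2 p' q' -> left_lcm u (v1 * v2) (p * p') q'.
Proof.
by move=> /left_lcmC l1 /left_lcmC l2; apply/left_lcmC/(left_lcmMl l1 l2).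
Qed.

Lemma left_lcm1 v : left_lcm 1 v v 1.
Proof. by split=> [|a b]; rewrite ?mul1g ?mulg1 // => ->; exists b; rewrite mul1g. Qed.

Lemma left_lcm_cancel u v : left_lcm u u 1 1 -> left_lcm u (u * v) v 1.
Proof.
move=> uu; rewrite -[X in left_lcm _ _ X]mul1g.
exact: left_lcmMr uu (left_lcm1 v).
Qed.

Lemma left_lcm_prod (I : eqType) (s : seq I) (F : I -> M) v :
    (forall i, i \in s -> left_lcm (F i) v v (F i)) ->
  left_lcm (\prod_(i <- s) F i) v v (\prod_(i <- s) F i).
Proof.
elim: s => [|i s IHs] Fv; first by rewrite big_nil; apply: left_lcm1.
rewrite big_cons; apply: (left_lcmMl (p := v)); first by apply: Fv; rewrite mem_head.
by apply: IHs => j sj; apply: Fv; rewrite inE sj orbT.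
Qed.

(** [q] is the complement of [u] after [v], here without mention of the other
complement: only this one is needed to move on to the next factor of a
product, and equivalences chain ([residueM]). *)
Definition residue u v q := forall b, ldvd u (v * b) <-> ldvd q b.

Lemma left_lcm_residue u v p q : left_lcm u v p q -> residue u v q.
Proof.
case=> e min b; split=> [[a /esym/min[c [_ ->]]] | [c ->]]; first by exists c.
by exists (p * c); rewrite !mulgA e.
Qed.

Lemma residue1 u : residue u 1 u.
Proof. by move=> b; rewrite mul1g. Qed.

Lemma residueM u v w q q' : residue u v q -> residue q w q' -> residue u (v * w) q'.
Proof. by move=> uv qw b; rewrite -mulgA uv. Qed.

End LeftLcm.

(** * Pushing a generator through the blocks *)

Section BlocksB.
Variable n : nat.
Local Notation M := (artinB n.+1).

(** Generators indexed by natural numbers, so that products over intervals can be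
split; the index is meaningful for [j <= n]. *)
Definition gen (j : nat) : M := xB (inord j).

Lemma gen_lcm i j (a := inord i : 'I_n.+1) (b := inord j : 'I_n.+1) :
  left_lcm (gen i) (gen j)
    (word_class (@artinB_rel n.+1) (artin_compl (@coxeterB _) a b))
    (word_class (@artinB_rel n.+1) (artin_compl (@coxeterB _) b a)).
Proof.
split; last exact: xB_mul_eq.
by rewrite /gen /xB -!word_class_cat artinB_compl_lcm.
Qed.

Lemma gen_lcm_refl i : left_lcm (gen i) (gen i) 1 1.
Proof.
by have := gen_lcm i i; rewrite /artin_compl /coxeterB eqxx.
Qed.

Lemma gen_lcm_far i j : i <= n -> j <= n -> (i.+2 <= j) || (j.+2 <= i) ->
  left_lcm (gen i) (gen j) (gen j) (gen i).
Proof.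
move=> len_i len_j far; have := gen_lcm i j.
rewrite /artin_compl (coxeterB_sym (inord j)) /coxeterB !inordK // far.
by case: eqP => // ij; lia.
Qed.

Lemma gen_lcm_braid3 i : 0 < i -> i < n ->
  left_lcm (gen i.+1) (gen i) (gen i * gen i.+1) (gen i.+1 * gen i).
Proof.
move=> i_gt0 lt_in; have := gen_lcm i.+1 i.
rewrite /artin_compl (coxeterB_sym (inord i)) /coxeterB !inordK; try lia.
do 3?[case: ifP => ?]; try (exfalso; lia).
by rewrite /= /gen /xB -!word_class_cat.
Qed.

Lemma gen_lcm_braid4 : 0 < n ->
  left_lcm (gen 1) (gen 0) (gen 0 * gen 1 * gen 0) (gen 1 * gen 0 * gen 1).
Proof.
move=> n_gt0; have := gen_lcm 1 0.
rewrite /artin_compl (coxeterB_sym (inord 0)) /coxeterB !inordK //=.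
have cl3 (a b c : 'I_n.+1) :
    word_class (@artinB_rel n.+1) [:: a; b; c] = xB a * xB b * xB c.
  by rewrite (word_class_cat _ [:: a; b] [:: c]) (word_class_cat _ [:: a] [:: b]).
by rewrite !cl3.
Qed.

Definition down j k : M := \prod_(i <- rev (index_iota j k.+1)) gen i.
Definition up j k : M := \prod_(j <= i < k.+1) gen i.

Lemma down_geq j k : k < j -> down j k = 1.
Proof. by move=> lt_kj; rewrite /down /index_iota (eqP lt_kj) big_nil. Qed.

Lemma up_geq j k : k < j -> up j k = 1.
Proof. by move=> lt_kj; rewrite /up big_geq. Qed.

Lemma downSr j k : j <= k.+1 -> down j k.+1 = gen k.+1 * down j k.
Proof.
move=> le_jk; rewrite /down /index_iota (subSn le_jk) -[(_ - j).+1]addn1 iotaD rev_cat.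
by rewrite big_cat /= big_seq1 subnKC.
Qed.

Lemma downSl j k : j <= k -> down j k = down j.+1 k * gen j.
Proof.
move=> le_jk; rewrite /down /index_iota (subSn le_jk) /= rev_cons -cats1.
by rewrite big_cat /= big_seq1 subSS.
Qed.

Lemma upSr j k : j <= k.+1 -> up j k.+1 = up j k * gen k.+1.
Proof. by move=> le_jk; rewrite /up big_nat_recr. Qed.

Lemma down_lcm_far j k i : k <= n -> i.+2 <= j ->
  left_lcm (down j k) (gen i) (gen i) (down j k).
Proof.
move=> len_k far; apply: left_lcm_prod => h.
rewrite mem_rev mem_index_iota => /andP[le_jh lt_hk].
by apply: gen_lcm_far; lia.
Qed.

(** The block [x_k ... x_1 x_0 x_1 ... x_k]. *)
Definition blk k := down 0 k * up 1 k.

Lemma residue_blk_far i k : i.+2 <= k <= n -> residue (gen k) (blk i) (gen k).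
Proof.
move=> /andP[lt_ik le_kn].
have far s : (forall h, h \in s -> h.+2 <= k) ->
    residue (gen k) (\prod_(h <- s) gen h) (gen k).
  move=> lt_sk; apply: left_lcm_residue; apply: left_lcmC; apply: left_lcm_prod.
  by move=> h /lt_sk lt_hk; apply: gen_lcm_far; lia.
apply: residueM; apply: far => h; rewrite ?mem_rev mem_index_iota; lia.
Qed.

Lemma down_cat i j k : i <= j.+1 -> j <= k -> down i k = down j.+1 k * down i j.
Proof.
move=> le_ij le_jk; rewrite /down -big_cat -rev_cat /index_iota.
have -> : k.+1 - i = (j.+1 - i) + (k.+1 - j.+1) by lia.
by rewrite iotaD subnKC.
Qed.

(** In [x_k ... x_{j+1}] only the last letter interacts with [x_j], and
[x_{j+1} x_j x_{j+1} = x_j x_{j+1} x_j] appends [x_j]. *)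
Lemma residue_down_step j k : 0 < j < k -> k <= n ->
  residue (down j.+1 k) (gen j) (down j k).
Proof.
move=> /andP[j_gt0 lt_jk] le_kn; rewrite (downSl (ltnW lt_jk)) (downSl lt_jk).
rewrite -mulgA; apply: left_lcm_residue.
by apply: left_lcmMl (down_lcm_far _ _) (gen_lcm_braid3 _ _); lia.
Qed.

Lemma residue_down j k : 0 < j <= k.+1 -> k < n ->
  residue (gen k.+1) (down j k) (down j k.+1).
Proof.
move=> /andP[j_gt0 le_jk] lt_kn.
rewrite -(subKn le_jk); have : k.+1 - j <= k by lia.
elim: (k.+1 - j) => [_|i IHi lt_ik].
  by rewrite subn0 downSr // down_geq // mulg1; apply: residue1.
have -> : k.+1 - i.+1 = k - i by lia.
have {}IHi := IHi (ltnW lt_ik); rewrite (subSn (ltnW lt_ik)) in IHi.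
rewrite (@downSl (k - i) k) ?leq_subr //; apply: residueM IHi _.
by apply: residue_down_step; lia.
Qed.

(** As for [residue_down_step], but the relation between [x_1] and [x_0] has length
4 and appends the two letters [x_0 x_1], the turning point of the block. *)
Lemma residue_down0 k : 0 < k <= n ->
  residue (down 1 k) (gen 0) (down 0 k * up 1 1).
Proof.
move=> /andP[k_gt0 le_kn]; rewrite (downSl (leq0n k)) (downSl k_gt0).
rewrite /up big_nat1 -!mulgA; apply: left_lcm_residue.
apply: left_lcmMl (down_lcm_far _ _) _ => //.
by rewrite mulgA; apply: gen_lcm_braid4; lia.
Qed.

(** Write the left word as [x_k ... x_{j+2} x_{j+1} x_j W x_j] with [W] in the
letters below [x_j].  The letters above [x_{j+1}] let [x_j] through; the braid
relation of [x_{j+1}] turns it into [x_j x_{j+1}], whose [x_j] is cancelled by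
the next letter; [x_{j+1}] commutes with [W]; and its lcm with the final [x_j]
appends [x_{j+1}]. *)
Lemma residue_up_step j k : 0 < j < k -> k <= n ->
  residue (down 0 k * up 1 j) (gen j) (down 0 k * up 1 j.+1).
Proof.
case: j => // j /= lt_jk le_kn; rewrite (@down_cat 0 j k) //; last by lia.
rewrite (@downSl j.+1 k) ?(@downSl j.+2 k); try lia.
(* The case distinction on [j] has shifted its index by one. *)
rewrite (@upSr 1 j.+1) // (@upSr 1 j) // -!mulgA; apply: left_lcm_residue.
have far_down : left_lcm (down j.+3 k) (gen j.+1) (gen j.+1) (down j.+3 k).
  exact: down_lcm_far.
have braid : left_lcm (gen j.+2) (gen j.+1)
  (gen j.+1 * gen j.+2) (gen j.+2 * gen j.+1) by apply: gen_lcm_braid3; lia.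
have far0 : left_lcm (down 0 j) (gen j.+2) (gen j.+2) (down 0 j).
  apply: left_lcm_prod => h; rewrite mem_rev mem_index_iota => lt_hj.
  by apply: gen_lcm_far; lia.
have far1 : left_lcm (up 1 j) (gen j.+2) (gen j.+2) (up 1 j).
  apply: left_lcm_prod => h; rewrite mem_index_iota => lt_hj.
  by apply: gen_lcm_far; lia.
have cancel := left_lcm_cancel (gen j.+2) (gen_lcm_refl j.+1).
have := left_lcmMl far_down (left_lcmMl braid (left_lcmMl cancel
  (left_lcmMl far0 (left_lcmMl far1 (left_lcmC braid))))).
by rewrite mul1g -!mulgA; apply.
Qed.

Lemma residue_up j k : j < k <= n ->
  residue (down 0 k * up 1 1) (up 1 j) (down 0 k * up 1 j.+1).
Proof.
move=> /andP[lt_jk le_kn]; elim: j lt_jk => [_|j IHj lt_jk].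
  by rewrite (@up_geq 1 0) //; apply: residue1.
rewrite (@upSr 1 j) //; apply: residueM (IHj (ltnW lt_jk)) _.
exact: residue_up_step.
Qed.

Lemma residue_blk k : k < n -> residue (gen k.+1) (blk k) (blk k.+1).
Proof.
move=> lt_kn; rewrite /blk (downSl (leq0n k)) -!mulgA.
apply: residueM (residue_down _ lt_kn) _ => //.
apply: residueM (residue_down0 _) _; first by rewrite lt_kn.
by apply: residue_up; rewrite ltnSn.
Qed.

Definition garside k : M := \prod_(0 <= i < k) blk i.

(** [x_k] commutes with all the letters of the first [k - 1] blocks, and the last
one transforms it into the next block. *)
Lemma residue_garside k : k <= n -> residue (gen k) (garside k) (blk k).
Proof.
case: k => [_|k lt_kn].
  rewrite /garside big_geq // /blk (up_geq (k := 0)) // mulg1.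
  by rewrite /down big_seq1; apply: residue1.
rewrite /garside big_nat_recr //=; apply: (residueM _ (residue_blk lt_kn)).
rewrite big_nat; apply: (big_rec (fun v => residue (gen k.+1) v (gen k.+1))).
  exact: residue1.
by move=> i v lt_ik; apply: residueM; apply: residue_blk_far; lia.
Qed.

(** The element [x_k] adds to divisibility by the first [k] blocks exactly the
condition expressed by [residue_garside]. *)
Lemma garside_ldvd k w : k <= n.+1 ->
  ldvd (garside k) w <-> forall i, i < k -> ldvd (gen i) w.
Proof.
elim: k w => [|k IHk] w le_kn.
  by split=> // _; exists w; rewrite /garside big_geq // mul1g.
rewrite {1}/garside big_nat_recr //= -/(garside k); split.
  case=> b ->; move=> i; rewrite ltnS leq_eqVlt => /orP[/eqP->|lt_ik].
    by rewrite -mulgA; apply/(residue_garside le_kn); exists b.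
  by rewrite -mulgA; apply: (IHk _ (ltnW le_kn)).1 => //; exists (blk k * b).
move=> gen_w; have [|b wE] := (IHk w (ltnW le_kn)).2.
  by move=> i /ltnW/gen_w.
have := gen_w k (ltnSn k); rewrite wE => /(residue_garside le_kn)[c ->].
by exists c; rewrite mulgA.
Qed.

(** * The Garside element *)

Lemma xB_gen (i : 'I_n.+1) : xB i = gen i.
Proof. by rewrite /gen inord_val. Qed.

Lemma filter_index_iota m a b : b < m ->
  [seq i <- index_iota 0 m | a <= i <= b] = index_iota a b.+1.
Proof.
move=> lt_bm; apply: (irr_sorted_eq ltn_trans ltnn).
- by apply: sorted_filter; [apply: ltn_trans | apply: iota_ltn_sorted].
- exact: iota_ltn_sorted.
- by move=> i; rewrite mem_filter !mem_index_iota; lia.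
Qed.

Lemma blockB_blk (k : 'I_n.+1) : blockB k = blk k.
Proof.
rewrite /blockB /blk; congr (_ * _).
  under eq_bigr do rewrite xB_gen.
  rewrite -(big_map val (fun j => j <= k) gen) map_rev val_enum_ord.
  by rewrite -big_filter filter_rev /down -(@filter_index_iota n.+1 0 k).
under eq_bigr do rewrite xB_gen.
rewrite -(big_mkord (fun j => 0 < j <= k) gen) -big_filter.
by rewrite filter_index_iota.
Qed.

Lemma deltaB_garside : deltaB n.+1 = garside n.+1.
Proof.
by rewrite /deltaB /garside big_mkord; apply: eq_bigr => k _; apply: blockB_blk.
Qed.

End BlocksB.

(** Lengths are invariant, so [a = a c d] forces [c] to be the empty word. *)
Lemma ldvd_anti n (a b : artinB n) : ldvd a b -> ldvd b a -> a = b.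
Proof.
case: (word_class_surj a) => u <- [c ->].
case: (word_class_surj c) => v <- [d]; case: (word_class_surj d) => w <-.
rewrite -mulgA -(word_class_cat _ v w) -(word_class_cat _ u (v ++ w)).
move=> /(word_class_size (@artinB_rel_size n)); rewrite !size_cat.
by case: v => [|? ?] /=; [rewrite mulg1 | lia].
Qed.

Theorem corollary2 (n : nat) (hn : 2 <= n) : is_garside (deltaB n).
Proof.
case: n hn => // n _; rewrite deltaB_garside.
have ldvd_delta w : ldvd (garside n n.+1) w <-> forall i : 'I_n.+1, ldvd (xB i) w.
  rewrite garside_ldvd //; split=> [gen_w i | x_w i lt_in].
    by rewrite xB_gen; apply: gen_w.
  by rewrite -[i]/(val (Ordinal lt_in)) -xB_gen.
split=> [|d [x_d d_min]].
  by split=> [|w /ldvd_delta //]; apply/ldvd_delta; exists 1; rewrite mulg1.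
apply: ldvd_anti; first exact/ldvd_delta.
by apply: d_min; apply/ldvd_delta; exists 1; rewrite mulg1.
Qed.
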